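(* Suppose that, for given $x_0\in\mathcal R_{init}$ and LTL formula $\phi$, the high level planner finds the sequence of regions of interest $\mathcal R^*_{seq}=\mathcal R^*_0\mathcal R^*_1\mathcal R^*_2\cdots$ (as described in the context). Moreover, suppose that the low level planner (the self-triggered control/communication algorithm described in the context) is implemented. Then the resulting state trajectory $\mathbf x=x_0x_1x_2\cdots$ satisfies $\phi$, i.e. $\mathrm{trace}(\mathbf x)\models\phi$. This holds for all $w_k\in\mathcal W$, $k\in\mathbb N$.
   Context: **System.** The plant is $x_{k+1}=Ax_k+Bu_k+w_k$, $k\in\mathbb N=\{0,1,2,\dots\}$, with $x_k\in\mathbb R^n$, $u_k\in\mathcal U\subset\mathbb R^m$, $w_k\in\mathcal W\subset\mathbb R^n$, where $\mathcal U,\mathcal W$ are polytopic sets containing the origin in their interiors. The free space $\mathcal X\subset\mathbb R^n$, in which the state is allowed to move, is polygonal, possibly non-convex. The regions of interest $\mathcal R_1,\dots,\mathcal R_{N_I}\subset\mathcal X$ are pairwise disjoint polytopes; $\mathcal R_{init}$ is one of them and $x_0\in\mathcal R_{init}$. For $i\ne j$, $\mathcal X_{ij}=\mathcal X\setminus\bigcup_{n\ne i,j}\mathcal R_n$. Set operations: $A\oplus B=\{x+y:x\in A,\,y\in B\}$, $A\ominus B=\{x:x+y\in A\ \forall y\in B\}$; $\mathrm{co}$ is the convex hull. **Trace of a trajectory.** Let $\Pi=\{\pi_1,\dots,\pi_{N_I}\}$ be atomic propositions. For $x\in\mathcal X$, $h_X(x)=\pi_i$ if $x\in\mathcal R_i$,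 and $h_X(x)=\pi_0$ (a dummy symbol not in $\Pi$) if $x$ lies in no $\mathcal R_i$. For $\mathbf x=x_0x_1\cdots$, the trajectory of interest is the subsequence $x_{k_0}x_{k_1}\cdots$ ($k_0<k_1<\cdots$) obtained by deleting all $x_k$ with $h_X(x_k)=\pi_0$. The trace $\mathrm{trace}(\mathbf x)=\rho_0\rho_1\cdots$ is given by: (1) $\rho_0=h_X(x_{k_0})$; (2) if $\rho_\ell=h_X(x_{k_i})$ and there is $j\ge i$ with $h_X(x_{k_i})=\cdots=h_X(x_{k_j})\ne h_X(x_{k_{j+1}})$, then $\rho_{\ell+1}=h_X(x_{k_{j+1}})$; (3) if $\rho_\ell=h_X(x_{k_i})$ and $h_X(x_{k_j})=h_X(x_{k_i})$ for all $j\ge i$, then $\rho_m=\rho_\ell$ for all $m\ge\ell$. The trajectory satisfies an LTL formula $\phi$ over $\Pi$ iff $\mathrm{trace}(\mathbf x)\models\phi$ (standard LTL semantics). **Transition system and tubes.** $\mathcal T=(S,s_{init},\delta,\Pi,g)$ with $S=\{s_1,\dots,s_{N_I}\}$, $\Gamma(s_i)=\mathcal R_i$, $g(s_i)=\pi_i$, $\Gamma(s_{init})=\mathcal R_{init}$. A path is an infinite sequence of states starting at $s_{init}$ with consecutive pairs in $\delta$; the trace of $s_0s_1\cdots$ is $g(s_0)g(s_1)\cdots$. - For $i\ne j$, $(s_i,s_j)\in\delta$ means reachability: there is a finite $L\ge1$ such that for any $x_0\in\mathcal R_i$ and $w_0,\dots,w_{L-1}\in\mathcal W$ there exist $u_0,\dots,u_{L-1}\in\mathcal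 U$ for which (C.1) $x_L\in\mathcal R_j$; (C.2) $x_\ell\in\mathcal X_{ij}$ for $0\le\ell\le L$; (C.3) if $x_{\ell'}\in\mathcal R_j$ for some $1\le\ell'\le L$, then $x_\ell\notin\mathcal R_i$ for $\ell'\le\ell\le L$. It is established as follows. Generate a nominal trajectory $\hat x_0,\dots,\hat x_L$ with $\hat x_0$ the Chebyshev center of $\mathcal R_i$, $\hat x_{k+1}=A\hat x_k+B\hat u_k$, $\hat u_k\in\mathcal U$, states in $\mathcal X_{ij}$, and $\hat x_L\in\mathcal R_j$; take a given polytope $\mathcal Z_{ij}=\mathrm{co}\{z_1,\dots,z_p\}$ containing $0$ in its interior; put $\bar\varepsilon_\ell=\max\{\varepsilon>0:\hat x_\ell\oplus\varepsilon\mathcal Z_{ij}\subseteq\mathcal X_{ij}\}$. With $x_{\ell,s}=\hat x_\ell+\varepsilon_\ell z_s$ and tubes $\mathcal X_\ell=\hat x_\ell\oplus\varepsilon_\ell\mathcal Z_{ij}=\mathrm{co}\{x_{\ell,1},\dots,x_{\ell,p}\}$, solve the tube problem: maximize $\varepsilon_0$ over $\varepsilon_\ell>0$ and $\mathcal U_\ell=\mathrm{co}\{u_{\ell,1},\dots,u_{\ell,p}\}$, $0\le\ell\le L$, subject to $\varepsilon_\ell\le\bar\varepsilon_\ell$ ($0\le\ell\le L$), $\mathcal X_L\subseteq\mathcal R_j$, and $Ax_{\ell,s}+Bu_{\ell,s}\in\mathcal X_{\ell+1}\ominus\mathcal W$, $u_{\ell,s}\in\mathcal U$ ($0\le\ell\le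 L-1$, $1\le s\le p$). The transition is included when an optimal solution is found satisfying (D.1) $\mathcal R_i\subseteq\mathcal X_0$ and (D.2) if $\mathcal X_{\ell'}\cap\mathcal R_j\ne\emptyset$ for $\ell'\in\{1,\dots,L-1\}$, then $\mathcal X_\ell\cap\mathcal R_i=\emptyset$ for all $\ell\in\{\ell',\dots,L-1\}$. From this optimal solution define the sequences $L_{x_0}(\mathcal R_i,\mathcal R_j)=\mathcal X_0\mathcal X_1\cdots\mathcal X_L$, $L_x(\mathcal R_i,\mathcal R_j)=\mathcal X_1\cdots\mathcal X_L$, $L_{u_0}(\mathcal R_i,\mathcal R_j)=\mathcal U_0\mathcal U_1\cdots\mathcal U_L$, $L_u(\mathcal R_i,\mathcal R_j)=\mathcal U_1\cdots\mathcal U_L$. - $(s_i,s_i)\in\delta$ means that $\mathcal R_i$ is robust controlled invariant, i.e. there is a control law $\kappa:\mathbb R^n\to\mathbb R^m$ with $Ax+B\kappa(x)+w\in\mathcal R_i$ for all $x\in\mathcal R_i$, $w\in\mathcal W$. It is established by finding $u_{1,i},\dots,u_{n_i,i}\in\mathcal U$ with $Av_{n,i}+Bu_{n,i}\in\mathcal R_i\ominus\mathcal W$ for all $n$, where $v_{1,i},\dots,v_{n_i,i}$ are the vertices of $\mathcal R_i$. Then $L_{x_0}(\mathcal R_i,\mathcal R_i)=L_x(\mathcal R_i,\mathcal R_i)=\mathcal R_i$ and $L_{u_0}(\mathcal R_i,\mathcal R_i)=L_u(\mathcal R_i,\mathcal R_i)=\mathrm{co}\{u_{1,i},\dots,u_{n_i,i}\}$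 (sequences with one element). **High level planner.** It finds a path $s^*_{seq}=s^*_0s^*_1\cdots$ of $\mathcal T$ with $\mathrm{trace}(s^*_{seq})\models\phi$, chosen shortest (smallest number of symbols in its prefix-suffix structure), so that if $s^*_i=s^*_{i+1}$ for some $i$, then $s^*_j=s^*_i$ for all $j\ge i$. Put $\mathcal R^*_i=\Gamma(s^*_i)$, so $\mathcal R^*_0=\mathcal R_{init}$; this gives $\mathcal R^*_{seq}$. **Concatenated tubes and control sets.** The infinite sequence of tubes $\mathcal X^*_0\mathcal X^*_1\mathcal X^*_2\cdots$ is the concatenation $L_{x_0}(\mathcal R^*_0,\mathcal R^*_1)\,L_x(\mathcal R^*_1,\mathcal R^*_2)\,L_x(\mathcal R^*_2,\mathcal R^*_3)\cdots$, and the infinite sequence of control sets $\mathcal U^*_0\mathcal U^*_1\mathcal U^*_2\cdots$ is the concatenation $L_{u_0}(\mathcal R^*_0,\mathcal R^*_1)\,L_u(\mathcal R^*_1,\mathcal R^*_2)\,L_u(\mathcal R^*_2,\mathcal R^*_3)\cdots$; here $L_{x_0}(\mathcal R^*_0,\mathcal R^*_1)=\mathcal X^*_0\cdots\mathcal X^*_{L_1}$, $L_{u_0}(\mathcal R^*_0,\mathcal R^*_1)=\mathcal U^*_0\cdots\mathcal U^*_{L_1}$, and for $i\ge1$, $L_x(\mathcal R^*_i,\mathcal R^*_{i+1})=\mathcal X^*_{L_i+1}\cdots\mathcal X^*_{L_{i+1}}$, $L_u(\mathcal R^*_i,\mathcal R^*_{i+1})=\mathcal U^*_{L_i+1}\cdots\mathcal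 U^*_{L_{i+1}}$, with the indices $L_i$ chosen to line up the sequences. For every $k$ write $\mathcal X^*_k=\mathrm{co}\{x^*_{1,k},\dots,x^*_{p_k,k}\}$ and $\mathcal U^*_k=\mathrm{co}\{u^*_{1,k},\dots,u^*_{p_k,k}\}$, where $p_k$ is the number of vertices of $\mathcal X^*_k$ and the listed points are the corresponding generating points of the tube and control set above. **Low level planner.** Fix a horizon $H\in\{1,2,\dots\}$. 1. Set $k=0$. 2. The plant transmits $x_k$ to the controller. 3. The controller computes $u_k,\dots,u_{k+H-1}\in\mathcal U$: set $\hat x_k=x_k$ and for $\ell=0,\dots,H-1$ put $u_{k+\ell}=\sum_{s=1}^{p_{k+\ell}}\lambda_{s,k+\ell}u^*_{s,k+\ell}$, $\hat x_{k+\ell+1}=A\hat x_{k+\ell}+Bu_{k+\ell}$, where $\lambda_{s,k+\ell}\in[0,1]$ are such that $\hat x_{k+\ell}=\sum_{s=1}^{p_{k+\ell}}\lambda_{s,k+\ell}x^*_{s,k+\ell}$ and $\sum_{s=1}^{p_{k+\ell}}\lambda_{s,k+\ell}=1$. 4. The controller computes the next communication time $k+\ell^*_k$, where $\ell^*_k=\max\{\ell'\in\{0,\dots,H\}:\hat x_{k+\ell}\oplus\mathcal W_\ell\subseteq\mathcal X^*_{k+\ell}\ \forall\,\ell\in\{0,\dots,\ell'\}\}$, with $\mathcal W_\ell=\bigoplus_{j=1}^{\ell}A^{j-1}\mathcal W$ (Minkowski sum; $\mathcal W_0=\{0\}$). 5. The controller transmits $u_k,\dots,u_{k+\ell^*_k-1}$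 to the plant; the plant applies them and sends $x_{k+\ell^*_k}$ to the controller. 6. Set $k\leftarrow k+\ell^*_k$ and return to step 2.
   Formalization: Added assumption: the low level planner does not stay forever (ℓ*=0) at the last tube of a transition between distinct regions; the tube problem leaves U_L unconstrained there, so the algorithm could stall and the infinite trajectory would not exist. *)

(* Defs.v *)
From HB Require Import structures.
From mathcomp Require Import all_boot all_order all_algebra.
From mathcomp Require Import boolp classical_sets reals topology normedtype.

Set Implicit Arguments.
Unset Strict Implicit.
Unset Printing Implicit Defensive.

Import Order.TTheory GRing.Theory Num.Theory.
Import numFieldNormedType.Exports.

Local Open Scope classical_set_scope.
Local Open Scope ring_scope.

Section SetOperations.
Context {R : realType}.

Definition msum (n : nat) (A C : set 'cV[R]_n) : set 'cV[R]_n :=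
  [set x + y | x in A & y in C].

Definition mdiff (n : nat) (A C : set 'cV[R]_n) : set 'cV[R]_n :=
  [set x | forall y, C y -> A (x + y)].

Definition conv (n p : nat) (v : 'I_p -> 'cV[R]_n) : set 'cV[R]_n :=
  [set x | exists lam : 'I_p -> R,
    [/\ forall s, 0 <= lam s <= 1, \sum_s lam s = 1
      & x = \sum_s lam s *: v s]].

(** Polytopes are bounded, nonempty, and not necessarily full-dimensional. *)
Definition polytope (n : nat) (P : set 'cV[R]_n) : Prop :=
  exists (p : nat) (v : 'I_p.+1 -> 'cV[R]_n), P = conv v.

Definition polyhedron (n : nat) (P : set 'cV[R]_n) : Prop :=
  exists (q : nat) (G : 'M[R]_(q, n)) (h : 'cV[R]_q),
    P = [set x | forall i, (G *m x) i 0 <= h i 0].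

(** Finite union of convex polyhedra: possibly non-convex. *)
Definition polygonal (n : nat) (P : set 'cV[R]_n) : Prop :=
  exists (q : nat) (C : 'I_q -> set 'cV[R]_n),
    (forall i, polyhedron (C i)) /\ P = \bigcup_i C i.

Definition extreme_point (n : nat) (P : set 'cV[R]_n) (v : 'cV[R]_n) : Prop :=
  P v /\ forall x y (t : R), P x -> P y -> 0 < t < 1 ->
           v = t *: x + (1 - t) *: y -> x = v /\ y = v.

Definition vertices_of (n p : nat) (P : set 'cV[R]_n)
    (v : 'I_p -> 'cV[R]_n) : Prop :=
  [/\ injective v, P = conv v
    & forall z, extreme_point P z <-> exists s, z = v s].

(** The norm is Euclidean; the library norm on matrices is the sup norm. *)
Definition closed_eball (n : nat) (c : 'cV[R]_n) (r : R) : set 'cV[R]_n :=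
  [set x | Num.sqrt (\sum_i (x i 0 - c i 0) ^+ 2) <= r].

(** Center of a largest ball inscribed in [P] (it need not be unique). *)
Definition chebyshev_center (n : nat) (P : set 'cV[R]_n) (c : 'cV[R]_n) : Prop :=
  exists r : R, [/\ 0 <= r, closed_eball c r `<=` P
    & forall c' r', 0 <= r' -> closed_eball c' r' `<=` P -> r' <= r].

End SetOperations.

Section LTL.

Inductive ltl (AP : Type) : Type :=
| Ltrue
| Latom of AP
| Lnot of ltl AP
| Land of ltl AP & ltl AP
| Lnext of ltl AP
| Luntil of ltl AP & ltl AP.

(** Each letter of [rho] is the single atomic proposition that holds there. *)
Fixpoint models_at (AP : Type) (rho : nat -> AP) (k : nat) (phi : ltl AP) : Prop :=
  match phi with
  | Ltrue => True
  | Latom a => rho k = a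
  | Lnot f => ~ models_at rho k f
  | Land f g => models_at rho k f /\ models_at rho k g
  | Lnext f => models_at rho k.+1 f
  | Luntil f g => exists j, models_at rho (k + j) g /\
                    forall i, (i < j)%N -> models_at rho (k + i) f
  end.

Definition models (AP : Type) (rho : nat -> AP) (phi : ltl AP) : Prop :=
  models_at rho 0 phi.

End LTL.

(** The [N] regions, the states of the transition system and the atomic
    propositions are all indexed by ['I_N]: the state [i] stands for the region
    [region P i] and is labelled by the proposition [i]. *)
Record problem (R : realType) (n m N : nat) := Problem {
  matA : 'M[R]_n;
  matB : 'M[R]_(n, m);
  inputs : set 'cV[R]_m;
  noise : set 'cV[R]_n;
  freespace : set 'cV[R]_n;
  region : 'I_N -> set 'cV[R]_n;
  initial : 'I_N
}.

Section Problem.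
Context {R : realType} {n m N : nat}.
Implicit Type P : problem R n m N.

Definition well_posed P : Prop :=
  [/\ polytope (inputs P) /\ interior (inputs P) 0,
      polytope (noise P) /\ interior (noise P) 0,
      polygonal (freespace P),
      forall i, polytope (region P i) /\ region P i `<=` freespace P
    & forall i j, i != j -> region P i `&` region P j = set0].

Definition corridor P (i j : 'I_N) : set 'cV[R]_n :=
  freespace P `\` \bigcup_(q in [set q | q != i /\ q != j]) region P q.

Definition step P (x : 'cV[R]_n) (u : 'cV[R]_m) : 'cV[R]_n :=
  matA P *m x + matB P *m u.

Fixpoint response P (x0 : 'cV[R]_n) (u : nat -> 'cV[R]_m)
    (w : nat -> 'cV[R]_n) (k : nat) : 'cV[R]_n :=
  if k is k'.+1 then step P (response P x0 u w k') (u k') + w k' else x0.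

(** [None] is the dummy symbol. The regions are pairwise disjoint, so the index
    that is picked is the only one. *)
Definition label P (x : 'cV[R]_n) : option 'I_N :=
  [pick i | `[< region P i x >]].

(** [kk] enumerates the instants of the trajectory of interest and [pos l] is
    the index, in that subsequence, from which the letter [rho l] is read. *)
Definition is_trace P (x : nat -> 'cV[R]_n) (rho : nat -> 'I_N) : Prop :=
  (forall k, freespace P (x k)) /\
  exists kk pos : nat -> nat,
    let y i := label P (x (kk i)) in
    [/\ forall i, (kk i < kk i.+1)%N,
        forall k, label P (x k) <> None <-> exists i, kk i = k
      & [/\ pos 0%N = 0%N,
        forall l, y (pos l) = Some (rho l),
        forall l j, (pos l <= j)%N ->
          (forall i, (pos l <= i <= j)%N -> y i = y (pos l)) ->
          y j.+1 <> y (pos l) -> pos l.+1 = j.+1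
      & forall l, (forall j, (pos l <= j)%N -> y j = y (pos l)) ->
          forall q, (l <= q)%N -> rho q = rho l]].

Definition satisfies P (x : nat -> 'cV[R]_n) (phi : ltl 'I_N) : Prop :=
  exists rho, is_trace P x rho /\ models rho phi.

Definition reachable P (i j : 'I_N) : Prop :=
  exists L : nat, (1 <= L)%N /\
  forall (x0 : 'cV[R]_n) (w : nat -> 'cV[R]_n),
    region P i x0 -> (forall l, (l < L)%N -> noise P (w l)) ->
  exists u : nat -> 'cV[R]_m,
    let x := response P x0 u w in
    [/\ forall l, (l < L)%N -> inputs P (u l),
        region P j (x L),
        forall l, (l <= L)%N -> corridor P i j (x l)
      & forall l', (1 <= l' <= L)%N -> region P j (x l') ->
          forall l, (l' <= l <= L)%N -> ~ region P i (x l)].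

Definition robust_controlled_invariant P (i : 'I_N) : Prop :=
  exists kappa : 'cV[R]_n -> 'cV[R]_m, forall x w,
    region P i x -> noise P w -> region P i (step P x (kappa x) + w).

End Problem.

(** Generating points of one tube together with the paired generating points of
    the control set used there. *)
Record stage (R : realType) (n m : nat) := Stage {
  npts : nat;
  xpt : 'I_npts -> 'cV[R]_n;
  upt : 'I_npts -> 'cV[R]_m
}.
Arguments npts {R n m}.
Arguments xpt {R n m}.
Arguments upt {R n m}.

Definition tube_set (R : realType) (n m : nat) (T : stage R n m) : set 'cV[R]_n :=
  conv (xpt T).

(** Data of the tube problem for one transition. The fields indexed by an
    instant are only meaningful up to [tlen]. *)
Record tube_data (R : realType) (n m : nat) := TubeData {
  tlen : nat;                             (* L *)
  tnum : nat;                             (* p *)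
  tgen : 'I_tnum -> 'cV[R]_n;             (* z_s *)
  tnomx : nat -> 'cV[R]_n;                (* nominal states *)
  tnomu : nat -> 'cV[R]_m;                (* nominal inputs *)
  tbar : nat -> R;                        (* upper bounds on the scalings *)
  teps : nat -> R;                        (* optimal scalings *)
  tinp : nat -> 'I_tnum -> 'cV[R]_m       (* optimal u_{l,s} *)
}.
Arguments tlen {R n m}.
Arguments tnum {R n m}.
Arguments tgen {R n m}.
Arguments tnomx {R n m}.
Arguments tnomu {R n m}.
Arguments tbar {R n m}.
Arguments teps {R n m}.
Arguments tinp {R n m}.

Section Tubes.
Context {R : realType} {n m N : nat}.
Implicit Types (P : problem R n m N) (T : tube_data R n m).

Definition tube_point T (eps : nat -> R) (l : nat) (s : 'I_(tnum T)) : 'cV[R]_n :=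
  tnomx T l + eps l *: tgen T s.
Arguments tube_point : clear implicits.

Definition tube_at T (eps : nat -> R) (l : nat) : set 'cV[R]_n :=
  conv (tube_point T eps l).

Definition nominal P (i j : 'I_N) T : Prop :=
  [/\ chebyshev_center (region P i) (tnomx T 0%N),
      forall l, (l < tlen T)%N ->
        inputs P (tnomu T l) /\ tnomx T l.+1 = step P (tnomx T l) (tnomu T l),
      forall l, (l <= tlen T)%N -> corridor P i j (tnomx T l)
    & region P j (tnomx T (tlen T))].

Definition admissible_scalings P (i j : 'I_N) T (l : nat) : set R :=
  [set e : R | 0 < e /\
     msum [set tnomx T l] [set e *: z | z in conv (tgen T)] `<=` corridor P i j].

Definition tube_feasible P (j : 'I_N) T
    (eps : nat -> R) (u : nat -> 'I_(tnum T) -> 'cV[R]_m) : Prop :=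
  [/\ forall l, (l <= tlen T)%N -> 0 < eps l <= tbar T l,
      tube_at T eps (tlen T) `<=` region P j
    & forall l s, (l < tlen T)%N ->
        mdiff (tube_at T eps l.+1) (noise P)
              (step P (tube_point T eps l s) (u l s)) /\
        inputs P (u l s)].

Definition tube_solution P (i j : 'I_N) T : Prop :=
  [/\ (1 <= tlen T)%N /\ nominal P i j T,
      interior (conv (tgen T)) 0,
      forall l, (l <= tlen T)%N ->
        admissible_scalings P i j T l (tbar T l) /\
        ubound (admissible_scalings P i j T l) (tbar T l),
      tube_feasible P j (teps T) (tinp T) /\
      (forall eps u, @tube_feasible P j T eps u -> eps 0%N <= teps T 0%N)
    & region P i `<=` tube_at T (teps T) 0 /\
      forall l', (1 <= l' < tlen T)%N ->
        tube_at T (teps T) l' `&` region P j !=set0 ->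
        forall l, (l' <= l < tlen T)%N ->
          tube_at T (teps T) l `&` region P i = set0].

Definition invariance_solution P (i : 'I_N) (S : stage R n m) : Prop :=
  vertices_of (region P i) (xpt S) /\
  forall s, inputs P (upt S s) /\
            mdiff (region P i) (noise P) (step P (xpt S s) (upt S s)).

Definition tube_stage T (l : nat) : stage R n m :=
  Stage (tube_point T (teps T) l) (tinp T l).

End Tubes.

Record transition_system (R : realType) (n m N : nat) := TransitionSystem {
  delta : rel 'I_N;
  tube : 'I_N -> 'I_N -> tube_data R n m;
  loop : 'I_N -> stage R n m
}.

(** One communication round per index [t]: it starts at the instant [comm t]
    and computes the predicted states [predict t l] and the inputs [plan t l]. *)
Record execution (R : realType) (n m : nat) := Execution {
  comm : nat -> nat;
  predict : nat -> nat -> 'cV[R]_n;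
  plan : nat -> nat -> 'cV[R]_m
}.
Arguments comm {R n m}.
Arguments predict {R n m}.
Arguments plan {R n m}.

Section Planners.
Context {R : realType} {n m N : nat}.
Implicit Types (P : problem R n m N) (D : transition_system R n m N).

Definition abstraction P D : Prop :=
  (forall i j, i != j -> delta D i j ->
     reachable P i j /\ tube_solution P i j (tube D i j)) /\
  (forall i, delta D i i ->
     robust_controlled_invariant P i /\ invariance_solution P i (loop D i)).

Definition is_path P D (s : nat -> 'I_N) : Prop :=
  s 0%N = initial P /\ forall k, delta D (s k) (s k.+1).

(** Prefix of [a] symbols followed by a suffix of [b] symbols repeated forever. *)
Definition prefix_suffix (s : nat -> 'I_N) (a b : nat) : Prop :=
  (0 < b)%N /\ forall k, (a <= k)%N -> s (k + b)%N = s k.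

Definition high_level_plan P D (phi : ltl 'I_N) (s : nat -> 'I_N) : Prop :=
  [/\ is_path P D s,
      models s phi,
      exists a b, prefix_suffix s a b /\
        forall s' a' b', is_path P D s' -> models s' phi ->
          prefix_suffix s' a' b' -> (a + b <= a' + b')%N
    & forall i, s i = s i.+1 -> forall j, (i <= j)%N -> s j = s i].

(** The [i]-th block of the concatenation; only the first block keeps the
    initial tube of its transition. *)
Definition block D (s : nat -> 'I_N) (i : nat) : seq (stage R n m) :=
  let a := s i in let b := s i.+1 in
  if a == b then [:: loop D a]
  else let T := tube D a b in
       [seq tube_stage T l | l <- if i == 0%N then iota 0 (tlen T).+1
                                  else iota 1 (tlen T)].

Definition blocks D (s : nat -> 'I_N) (q : nat) : seq (stage R n m) :=
  flatten [seq block D s i | i <- iota 0 q].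

(** Blocks are nonempty, so the first [k.+1] of them contain the position [k]. *)
Definition stage_at D (s : nat -> 'I_N) (k : nat) : stage R n m :=
  nth (loop D (s 0%N)) (blocks D s k.+1) k.

(** Position in the concatenation of the last tube of the [i]-th block. *)
Definition block_end D (s : nat -> 'I_N) (i : nat) : nat :=
  (size (blocks D s i.+1)).-1.

Definition noise_sum P (l : nat) : set 'cV[R]_n :=
  \big[@msum R n/[set 0]]_(1 <= j < l.+1) [set matA P ^+ j.-1 *m w | w in noise P].

Definition planning_step P (T : stage R n m) (x x' : 'cV[R]_n) (u : 'cV[R]_m) : Prop :=
  inputs P u /\ x' = step P x u /\
  exists lam : 'I_(npts T) -> R,
    [/\ forall s, 0 <= lam s <= 1, \sum_s lam s = 1,
        x = \sum_s lam s *: xpt T s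
      & u = \sum_s lam s *: upt T s].

(** The maximum is over a nonempty set whenever the current state lies in the
    current tube. *)
Definition silent_time P D (s : nat -> 'I_N) (H : nat) (E : execution R n m) (t : nat) : nat :=
  \max_(l < H.+1 | `[< forall l', (l' <= l)%N ->
      msum [set predict E t l'] (noise_sum P l')
        `<=` tube_set (stage_at D s (comm E t + l')) >]) l.

Definition low_level_run P D (s : nat -> 'I_N) (H : nat) (E : execution R n m)
    (x : nat -> 'cV[R]_n) (u : nat -> 'cV[R]_m) (w : nat -> 'cV[R]_n) : Prop :=
  [/\ comm E 0 = 0%N,
      forall t, predict E t 0 = x (comm E t) /\
        forall l, (l < H)%N ->
          planning_step P (stage_at D s (comm E t + l))
            (predict E t l) (predict E t l.+1) (plan E t l),
      forall t, comm E t.+1 = (comm E t + silent_time P D s H E t)%N,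
      forall t k, (comm E t <= k < comm E t.+1)%N -> u k = plan E t (k - comm E t)
    & forall k, x k.+1 = step P (x k) (u k) + w k].

(** When a round transmits no input ([silent_time] is 0), the loop returns to
    the same instant; if this goes on forever, no further state is generated.
    The tube problem rules this out at every instant except at the last tube of
    a transition between distinct regions, whose inputs [tinp T (tlen T)] it
    leaves unconstrained; for the trajectory to be infinite, the execution must
    eventually leave such an instant. *)
Definition passes_block_ends D (s : nat -> 'I_N) (E : execution R n m) : Prop :=
  forall t i, s i != s i.+1 -> comm E t = block_end D s i ->
    exists t', (comm E t < comm E t')%N.

End Planners.

(* Main.v *)
Require Import Defs.
From mathcomp Require Import all_boot all_order all_algebra.
From mathcomp Require Import boolp classical_sets reals topology normedtype.
From mathcomp Require Import zify.

(** The trajectory never leaves the concatenated tubes, and a trajectory that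
    stays in the tubes has the planned sequence of regions as its trace.

    Tubes.  At a communication instant the state is a convex combination of the
    generating points of the current tube, because the controller has computed
    such weights ([planning_step_tube]).  Until the next one, the state differs
    from the prediction by an accumulated disturbance in [noise_sum]
    ([predicted_state]), and the communication time is the largest one for which
    the prediction plus any such disturbance stays in the tubes ([silent_tube]).
    Hence the state is in the tube at every instant that the rounds reach.  They
    reach all instants: from a tube whose paired inputs are robust, convexity
    gives membership one step ahead, so that a round lasts at least one step
    ([silent_time_gt0]); the other tubes are the last ones of the transitions
    between distinct regions ([block_end_or_robust]), and these are left because
    of [passes_block_ends] ([run_in_tubes]).

    Trace.  Each block of tubes starts when the state is in the region [s i].  If
    [s i] and [s i.+1] differ, the corridor allows no other region during the
    block, and once [s i.+1] has been entered, [s i] is not visited again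
    before the block ends ([state_in_corridor], [no_return]); if they are equal,
    the plan and the state stay in [s i] forever ([state_in_loop]).  So the
    visited regions, with consecutive repetitions merged and the last one, if
    any, repeated forever, are exactly [s], the instant of the i-th switch being
    the first visit of [s i] after the start of the preceding block
    ([is_trace_of_transitions]). *)

Import GRing.Theory.
Local Open Scope ring_scope.

Set Implicit Arguments.
Unset Strict Implicit.
Unset Printing Implicit Defensive.

Import Order.TTheory Num.Theory.
Local Open Scope classical_set_scope.

(** * Convex combinations *)

Section Convex.
Context {R : realType} {n : nat}.

(** The weight of [v s] is the average, with weights [lam], of its weights in the
    points [y j]; exchanging the two sums gives everything, the bound by 1
    included. *)
Lemma conv_sum (J : finType) (p : nat) (v : 'I_p -> 'cV[R]_n)
    (lam : J -> R) (y : J -> 'cV[R]_n) :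
  (forall j, 0 <= lam j) -> \sum_j lam j = 1 -> (forall j, conv v (y j)) ->
  conv v (\sum_j lam j *: y j).
Proof.
move=> lam0 lam1 /choice[c cP].
exists (fun s => \sum_j lam j * c j s); split=> [s||].
- have c01 j : 0 <= c j s <= 1 by case: (cP j).
  apply/andP; split.
    by apply: sumr_ge0 => j _; rewrite mulr_ge0 //; case/andP: (c01 j).
  rewrite -lam1; apply: ler_sum => j _.
  by rewrite ler_piMr //; case/andP: (c01 j).
- rewrite exchange_big -[RHS]lam1 /=; apply: eq_bigr => j _.
  by case: (cP j) => _ c1 _; rewrite -mulr_sumr c1 mulr1.
- under [RHS]eq_bigr do rewrite scaler_suml.
  rewrite exchange_big /=; apply: eq_bigr => j _.
  case: (cP j) => _ _ {1}->; rewrite scaler_sumr.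
  by apply: eq_bigr => s _; rewrite scalerA.
Qed.

Lemma conv_shrink (p : nat) (v : 'I_p -> 'cV[R]_n) (z : 'cV[R]_n) (r : R) :
  conv v 0 -> conv v z -> 0 <= r <= 1 -> conv v (r *: z).
Proof.
move=> v0 vz /andP[r0 r1].
have := @conv_sum bool p v (fun b => if b then r else 1 - r)
  (fun b => if b then z else 0).
rewrite !big_bool /= scaler0 addr0; apply.
- by case=> //; rewrite subr_ge0.
- by rewrite addrC subrK.
- by case.
Qed.

End Convex.

(** * Traces of trajectories made of consecutive transitions *)

(** [kk i.+1] is the first element of [p] after [kk i]; no element is skipped. *)
Lemma enumerate_infinite (p : pred nat) :
  (forall k, exists k', (k <= k')%N && p k') ->
  exists kk : nat -> nat,
    (forall i, (kk i < kk i.+1)%N) /\ (forall k, p k <-> exists i, kk i = k).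
Proof.
move=> inf; pose next k := ex_minn (inf k).
have next_p k : p (next k) by rewrite /next; case: ex_minnP => ? /andP[].
have next_ge k : (k <= next k)%N by rewrite /next; case: ex_minnP => ? /andP[].
have next_le k k' : (k <= k')%N -> p k' -> (next k <= k')%N.
  by move=> lek pk; rewrite /next; case: ex_minnP => ? _; apply; rewrite lek.
pose kk := fix kk i := if i is i'.+1 then next (kk i').+1 else next 0%N.
have kkS i : (kk i < kk i.+1)%N by exact: next_ge.
exists kk; split=> // k; split=> [pk|[i <-]]; last by case: i => [|i]; exact: next_p.
have kk_ge i : (i <= kk i)%N by elim: i => // i /leq_ltn_trans; apply.
have ex_i : exists i, (k <= kk i)%N by exists k.
case: (ex_minnP ex_i) => i ki imin; exists i; apply/eqP.
rewrite eqn_leq ki andbT; case: i imin {ki} => [|i] imin; apply: next_le => //.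
by rewrite ltnNge; apply/negP => /imin; rewrite ltnn.
Qed.

Section Traces.
Context {R : realType} {n m N : nat}.
Implicit Types (P : problem R n m N) (x : nat -> 'cV[R]_n) (s : nat -> 'I_N).

Lemma labelE P y i : well_posed P -> label P y = Some i <-> region P i y.
Proof.
case=> _ _ _ _ disj; rewrite /label; split.
  by case: pickP => // j /asboolP rj [<-].
move=> ri; case: pickP => [j /asboolP rj|/(_ i)]; last by move/asboolP.
have [-> //|ne] := eqVneq j i.
by have := disj _ _ ne; rewrite -subset0 => /(_ y); case.
Qed.

(** [f l] is the instant of the [l]-th switch of label: from [f l] until [f l.+1]
    the only region met is [s l]. The index [pos l] of the trace is then the rank
    of [f l] among the labelled instants. When [s] becomes stationary there are
    no more switches, so the next value of [f] only has to carry the label. *)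
Lemma is_trace_of_switches P x s (f : nat -> nat) :
  (forall k, freespace P (x k)) ->
  f 0%N = 0%N ->
  (forall l, label P (x (f l)) = Some (s l)) ->
  (forall l, (f l <= f l.+1)%N) ->
  (forall l k i, s l != s l.+1 -> (f l <= k < f l.+1)%N ->
     label P (x k) = Some i -> i = s l) ->
  (forall l k i, s l = s l.+1 -> (f l <= k)%N ->
     label P (x k) = Some i -> i = s l) ->
  (forall l, s l = s l.+1 -> forall q, (l <= q)%N -> s q = s l) ->
  (forall k, exists k', (k <= k')%N && (label P (x k') != None)) ->
  is_trace P x s.
Proof.
move=> free f0 fs f_le stay settle const inf; split=> //.
have [kk [kkS kkP]] := enumerate_infinite inf.
have leq_kk : {mono kk : i j / (i <= j)%N}.
  by apply: leq_mono; apply: homo_ltn => // ? ? ?; apply: ltn_trans.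
have labelled i : label P (x (kk i)) <> None.
  by apply/eqP/kkP; exists i.
have /choice[pos posP] l : exists i, kk i = f l.
  by apply/kkP; rewrite fs.
have yposE l : label P (x (kk (pos l))) = Some (s l) by rewrite posP.
exists kk, pos => y; split=> //.
  by move=> k; rewrite -kkP; split=> /eqP.
split=> // [|l j lj cst|l cst q lq].
- have [i0 i0E] : exists i, kk i = 0%N by apply/kkP; rewrite -f0 fs.
  have : (kk (pos 0%N) <= kk 0%N)%N by rewrite posP f0.
  by rewrite leq_kk leqn0 => /eqP.
- rewrite {2}/y yposE => jS.
  have fj : (f l <= kk j.+1)%N by rewrite -posP leq_kk leqW.
  have [i yi] : exists i, y j.+1 = Some i.
    by have := labelled j.+1; rewrite /y; case: label => // i; exists i.
  have ne : s l != s l.+1.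
    apply/eqP => eqs; case: jS; rewrite yi; congr Some.
    exact: (settle _ _ _ eqs fj yi).
  apply/eqP; rewrite eqn_leq; apply/andP; split.
    rewrite -leq_kk posP leqNgt; apply/negP => ltf; case: jS.
    by rewrite yi (stay _ _ _ ne _ yi) ?fj.
  rewrite ltnNge; apply/negP => le_j.
  have le_pos : (pos l <= pos l.+1)%N by rewrite -leq_kk !posP.
  have := cst (pos l.+1); rewrite le_pos le_j /y !yposE => /(_ isT)[].
  by move/eqP; rewrite eq_sym (negbTE ne).
- apply: const lq.
  have le_pos : (pos l <= pos l.+1)%N by rewrite -leq_kk !posP.
  by have := cst _ le_pos; rewrite /y !yposE => -[].
Qed.

(** Transition [l] takes place between [e l] and [e l.+1]. The region [s l.+1] may
    be entered well before [e l.+1], so the [l.+1]-st switch is the first visit of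
    [s l.+1] after [e l], not [e l.+1] itself. *)
Lemma is_trace_of_transitions P x s (e : nat -> nat) :
  (forall k, freespace P (x k)) ->
  e 0%N = 0%N ->
  (forall l, (e l <= e l.+1)%N) ->
  (forall k, exists l, (k <= e l)%N) ->
  (forall l, label P (x (e l)) = Some (s l)) ->
  (forall l k i, s l != s l.+1 -> (e l <= k <= e l.+1)%N ->
     label P (x k) = Some i -> i = s l \/ i = s l.+1) ->
  (forall l k k', s l != s l.+1 -> (e l <= k)%N -> (k <= k' <= e l.+1)%N ->
     label P (x k) = Some (s l.+1) -> label P (x k') <> Some (s l)) ->
  (forall l k, s l = s l.+1 -> (e l <= k)%N -> label P (x k) = Some (s l)) ->
  (forall l, s l = s l.+1 -> forall q, (l <= q)%N -> s q = s l) ->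
  is_trace P x s.
Proof.
move=> free e0 eS unb visit within noreturn settled const.
(* [e l.-1] is the start of the preceding block, and 0 when [l] is 0. *)
have /choice[f fP] l : exists k, [/\ (e l.-1 <= k <= e l)%N,
    label P (x k) = Some (s l)
    & forall k', (e l.-1 <= k' < k)%N -> label P (x k') <> Some (s l)].
  have ex_k : exists k, (e l.-1 <= k)%N && (label P (x k) == Some (s l)).
    by exists (e l); rewrite visit eqxx andbT; case: l => [|l] //=.
  case: (ex_minnP ex_k) => k /andP[ek /eqP xk] kmin; exists k; split=> //.
    by rewrite ek kmin // visit eqxx andbT; case: (l) => [|?] /=.
  move=> k' /andP[ek' lt_k] /eqP xk'.
  by have := kmin k'; rewrite ek' xk' leqNgt lt_k => /(_ isT).
have before l k i : (f l <= k <= e l)%N -> label P (x k) = Some i -> i = s l.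
  case: l => [|l].
    by rewrite e0 leqn0 => /andP[_ /eqP->]; have := visit 0%N; rewrite e0 => -> [].
  have [/andP[el _] xf _] := fP l.+1.
  case/andP=> fk ke xk.
  have [eqs|ne] := eqVneq (s l) (s l.+1).
    move: xk; rewrite (settled _ _ eqs); last exact: leq_trans fk.
    by rewrite eqs => -[].
  have [||//] := within _ _ _ ne _ xk; first by rewrite ke (leq_trans el).
  move=> i_s; case: (noreturn l (f l.+1) k ne el _ xf); first by rewrite fk.
  by rewrite xk i_s.
apply: (is_trace_of_switches (f := f)) => //.
- by have [/andP[_ f_le] _ _] := fP 0%N; move: f_le; rewrite e0 leqn0 => /eqP.
- by move=> l; have [] := fP l.
- move=> l; have [/andP[_ le1] _ _] := fP l; have [/andP[le2 _] _ _] := fP l.+1.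
  exact: leq_trans le2.
- move=> l k i ne /andP[fk kf] xk.
  have [ke|/ltnW ek] := leqP k (e l); first by apply: before xk; rewrite fk.
  have [/andP[_ fe] _ fmin] := fP l.+1.
  have [|//|] := within _ _ _ ne _ xk; first by rewrite ek (leq_trans (ltnW kf)).
  by move=> i_s; case: (fmin k) => /=; rewrite ?ek // xk i_s.
- move=> l k i eqs fk xk.
  have [ke|/ltnW ek] := leqP k (e l); first by apply: before xk; rewrite fk.
  by move: xk; rewrite (settled _ _ eqs ek) => -[].
- by move=> k; have [l kl] := unb k; exists (e l); rewrite kl visit.
Qed.

End Traces.

(** * Positions in the concatenated sequence of tubes *)

Section Positions.
Context {R : realType} {n m N : nat}.
Variables (D : transition_system R n m N) (s : nat -> 'I_N).
Hypothesis tlen_gt0 :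
  forall i, s i != s i.+1 -> (0 < tlen (tube D (s i) (s i.+1)))%N.

(** Position of the last tube of block [i.-1], which is also where block [i]
    takes over: only the first block keeps its own initial tube. For [i] equal
    to 0 the predecessor is truncated and the position is 0, as it should. *)
Definition block_start (i : nat) : nat := (size (blocks D s i)).-1.

Lemma blocksS i : blocks D s i.+1 = blocks D s i ++ block D s i.
Proof. by rewrite /blocks -addn1 iotaD map_cat flatten_cat /= cats0. Qed.

Lemma size_block_gt0 i : (0 < size (block D s i))%N.
Proof.
rewrite /block; case: eqVneq => // /tlen_gt0 gt0.
by rewrite size_map; case: ifP; rewrite size_iota.
Qed.

Lemma leq_size_blocks i : (i <= size (blocks D s i))%N.
Proof.
elim: i => // i IH; rewrite blocksS size_cat -addn1.
by rewrite leq_add // size_block_gt0.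
Qed.

Lemma blocks_cat i j : (i <= j)%N -> exists r, blocks D s j = blocks D s i ++ r.
Proof.
move/subnKC <-; elim: (j - i)%N => [|d [r IH]].
  by exists [::]; rewrite addn0 cats0.
by exists (r ++ block D s (i + d)); rewrite addnS blocksS IH catA.
Qed.

(** The first [k.+1] blocks, in which [stage_at] looks for the position [k],
    extend the first [i.+1] ones. *)
Lemma stage_at_block i l : (l < size (block D s i))%N ->
  stage_at D s (size (blocks D s i) + l)
    = nth (loop D (s 0%N)) (block D s i) l.
Proof.
move=> lt_l; rewrite /stage_at.
have [|r ->] := @blocks_cat i.+1 (size (blocks D s i) + l).+1.
  by rewrite ltnS (leq_trans (leq_size_blocks i)) // leq_addr.
rewrite blocksS -catA nth_cat ltnNge leq_addr /= addKn.
by rewrite nth_cat lt_l.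
Qed.

(** Position [block_start i] itself is in block [i] only when [i] is 0. *)
Lemma stage_at_tube i l : s i != s i.+1 -> (0 < i -> 0 < l)%N ->
  (l <= tlen (tube D (s i) (s i.+1)))%N ->
  stage_at D s (block_start i + l) = tube_stage (tube D (s i) (s i.+1)) l.
Proof.
move=> ne; have gt0 := tlen_gt0 ne; set T := tube _ _ _ in gt0 * => l_gt0 le_l.
case: i => [|i] in ne @T gt0 l_gt0 le_l *.
  rewrite -[(block_start 0 + l)%N]/(size (blocks D s 0) + l)%N.
  have blockE : block D s 0 = [seq tube_stage T l | l <- iota 0 (tlen T).+1].
    by rewrite /block (negbTE ne).
  rewrite stage_at_block blockE ?size_map ?size_iota //.
  by rewrite (nth_map 0%N) ?size_iota // nth_iota.
have [{}l_gt0 szgt0] := (l_gt0 isT, leq_trans (ltn0Sn i) (leq_size_blocks i.+1)).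
have -> : (block_start i.+1 + l = size (blocks D s i.+1) + l.-1)%N.
  by rewrite /block_start; lia.
have blockE : block D s i.+1 = [seq tube_stage T l | l <- iota 1 (tlen T)].
  by rewrite /block (negbTE ne).
rewrite stage_at_block blockE ?size_map ?size_iota ?prednK //.
by rewrite (nth_map 0%N) ?size_iota ?prednK // nth_iota ?prednK // add1n prednK.
Qed.

Lemma stage_at_loop i : s i = s i.+1 ->
  stage_at D s (size (blocks D s i)) = loop D (s i).
Proof.
move=> eqs; have blockE : block D s i = [:: loop D (s i)].
  by rewrite /block -eqs eqxx.
by rewrite -[size _]addn0 stage_at_block blockE.
Qed.

Lemma block_start_loop i : s i = s i.+1 ->
  block_start i.+1 = size (blocks D s i).
Proof.
by move=> eqs; rewrite /block_start blocksS size_cat /block -eqs eqxx addn1.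
Qed.

Lemma block_start_tube i : s i != s i.+1 ->
  block_start i.+1 = (block_start i + tlen (tube D (s i) (s i.+1)))%N.
Proof.
move=> ne; rewrite /block_start blocksS size_cat /block (negbTE ne) size_map.
case: i => [|i] in ne *; first by rewrite size_iota.
have := leq_size_blocks i.+1; rewrite /= size_iota; lia.
Qed.

Lemma block_start_leS i : (block_start i <= block_start i.+1)%N.
Proof. by rewrite /block_start blocksS size_cat; lia. Qed.

Lemma leq_block_start i : (i <= block_start i.+1)%N.
Proof. by have := leq_size_blocks i.+1; rewrite /block_start; lia. Qed.

Lemma in_some_block k :
  exists i, (size (blocks D s i) <= k < size (blocks D s i.+1))%N.
Proof.
have ex_i : exists i, (k < size (blocks D s i))%N.
  by exists k.+1; exact: leq_size_blocks.
case: (ex_minnP ex_i) => -[|i] // lt_k imin; exists i; rewrite lt_k andbT.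
by rewrite leqNgt; apply/negP => /imin; rewrite ltnn.
Qed.

End Positions.

(** * The state never leaves the tubes *)

Section Run.
Context {R : realType} {n m N : nat}.
Implicit Types (P : problem R n m N) (D : transition_system R n m N).


Lemma mulmx_msum (A : 'M[R]_n) (r : seq nat) (F : nat -> set 'cV[R]_n) e :
  (\big[@msum R n/[set 0]]_(j <- r) F j) e ->
  (\big[@msum R n/[set 0]]_(j <- r) [set A *m y | y in F j]) (A *m e).
Proof.
elim: r e => [|j r IH] e; rewrite ?big_nil ?big_cons.
  by move=> ->; rewrite mulmx0.
case=> y Fy [z Fz <-]; exists (A *m y); first by exists y.
by exists (A *m z); [exact: IH | rewrite mulmxDr].
Qed.

(** The disturbance accumulated so far is moved by the dynamics, which shifts
    the exponents of [matA P] by one, and a new one is added. *)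
Lemma noise_sumS P l e w : noise_sum P l e -> noise P w ->
  noise_sum P l.+1 (matA P *m e + w).
Proof.
move=> We Ww; rewrite /noise_sum big_ltn // big_add1 /=.
exists w; first by exists w => //=; rewrite expr0 mul1mx.
exists (matA P *m e); last by rewrite addrC.
have -> : \big[@msum R n/[set 0]]_(1 <= j < l.+1)
    [set matA P ^+ j *m y | y in noise P] =
  \big[@msum R n/[set 0]]_(1 <= j < l.+1)
    [set matA P *m y | y in [set matA P ^+ j.-1 *m y | y in noise P]].
  apply: eq_big_nat => -[|j] // _; rewrite image_comp; congr image.
  by apply/funext => y /=; rewrite exprS -mulmxE mulmxA.
exact: mulmx_msum.
Qed.

Lemma planning_step_tube P (T : stage R n m) y y' v :
  planning_step P T y y' v -> tube_set T y.
Proof. by case=> _ [_ [lam [lam01 lam1 yE _]]]; exists lam. Qed.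

Definition robust_stage P (T T' : stage R n m) : Prop :=
  forall q, mdiff (tube_set T') (noise P) (step P (xpt T q) (upt T q)).

(** The same weights combine the generating states and the paired inputs, and
    the dynamics is affine: the successor is the combination, with these
    weights, of successors that all lie in the convex set [tube_set T']. *)
Lemma planning_step_robust P (T T' : stage R n m) y y' v w :
  robust_stage P T T' ->
  planning_step P T y y' v -> noise P w -> tube_set T' (y' + w).
Proof.
move=> robust [_ [-> [lam [lam01 lam1 -> ->]]]] Ww.
have -> : step P (\sum_q lam q *: xpt T q) (\sum_q lam q *: upt T q) + w
    = \sum_q lam q *: (step P (xpt T q) (upt T q) + w).
  rewrite /step !mulmx_sumr -big_split /=.
  under [RHS]eq_bigr do rewrite scalerDr.
  rewrite [RHS]big_split /= -scaler_suml lam1 scale1r; congr (_ + _).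
  by apply: eq_bigr => q _; rewrite scalerDr !scalemxAr.
by apply: conv_sum => // q; [case/andP: (lam01 q) | exact: robust].
Qed.

Section Execution.
Variables (P : problem R n m N) (D : transition_system R n m N).
Variables (s : nat -> 'I_N) (H : nat) (E : execution R n m).
Variables (x : nat -> 'cV[R]_n) (u : nat -> 'cV[R]_m) (w : nat -> 'cV[R]_n).
Hypotheses (H_gt0 : (0 < H)%N) (Ww : forall k, noise P (w k)).
Hypothesis run : low_level_run P D s H E x u w.

Let safe t l := forall l', (l' <= l)%N ->
  msum [set predict E t l'] (noise_sum P l')
    `<=` tube_set (stage_at D s (comm E t + l')).

(** The maximum that defines [silent_time] is attained: 0 is always a candidate,
    because the controller has written the current state as a convex combination
    of the points of the current tube. *)
Lemma silent_time_safe t :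
  (silent_time P D s H E t <= H)%N /\ safe t (silent_time P D s H E t).
Proof.
have [_ pred _ _ _] := run; have [_ /(_ _ H_gt0) plan0] := pred t.
have safe0 : safe t 0.
  move=> l'; rewrite leqn0 => /eqP-> z [y -> [e]].
  rewrite /noise_sum big_geq // => -> <-; rewrite addr0.
  exact: planning_step_tube plan0.
have gt0 : (0 < #|[pred l : 'I_H.+1 | `[< safe t l >]]|)%N.
  by apply/card_gt0P; exists ord0; apply/asboolP.
have [l /asboolP sl maxE] := eq_bigmax_cond (fun l : 'I_H.+1 => l : nat) gt0.
have -> : silent_time P D s H E t = l by exact: maxE.
by split=> //; rewrite -ltnS.
Qed.

Lemma predicted_state t l : (l <= silent_time P D s H E t)%N ->
  msum [set predict E t l] (noise_sum P l) (x (comm E t + l)).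
Proof.
have [_ pred commS plan xS] := run; have [pred0 predS] := pred t.
have [silentH _] := silent_time_safe t.
elim: l => [|l IH] lt_l.
  exists (predict E t 0) => //; exists 0; first by rewrite /noise_sum big_geq.
  by rewrite addr0 addn0.
have [y -> [e We xE]] := IH (ltnW lt_l).
have [_ [stepE _]] := predS _ (leq_trans lt_l silentH).
exists (predict E t l.+1) => //; exists (matA P *m e + w (comm E t + l)).
  exact: noise_sumS.
rewrite addnS xS (plan t) ?commS ?leq_addr ?ltn_add2l // addKn -xE stepE.
by rewrite /step mulmxDr -!addrA; congr (_ + _); rewrite addrCA.
Qed.

Lemma silent_tube t l : (l <= silent_time P D s H E t)%N ->
  tube_set (stage_at D s (comm E t + l)) (x (comm E t + l)).
Proof.
move=> le_l; have [_ sfe] := silent_time_safe t.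
exact: (sfe l le_l _ (predicted_state le_l)).
Qed.

Lemma silent_time_gt0 t :
  robust_stage P (stage_at D s (comm E t)) (stage_at D s (comm E t).+1) ->
  (0 < silent_time P D s H E t)%N.
Proof.
move=> robust; have [_ pred _ _ _] := run.
have [_ /(_ _ H_gt0)] := pred t; rewrite addn0 => plan0.
have lt1 : (1 < H.+1)%N by [].
rewrite /silent_time.
apply: (@leq_bigmax_cond _ _ (fun l : 'I_H.+1 => l : nat) (Ordinal lt1)).
apply/asboolP => -[|[|//]] _ z; last first.
  case=> y -> [e We <-]; rewrite addn1.
  apply: planning_step_robust robust plan0 _.
  move: We; rewrite /noise_sum big_ltn // big_geq // expr0 => -[_ [e' We' <-]].
  by case=> z' -> <-; rewrite mul1mx addr0.
have [_ sfe] := silent_time_safe t; exact: (sfe 0%N).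
Qed.

(** The instants [comm E t] are unbounded, so every instant falls within some
    round, where [silent_tube] applies. *)
Lemma run_in_tubes :
  (forall c, exists i, s i != s i.+1 /\ c = block_end D s i \/
     robust_stage P (stage_at D s c) (stage_at D s c.+1)) ->
  passes_block_ends D s E ->
  forall k, tube_set (stage_at D s k) (x k).
Proof.
move=> ends pass k; have [comm0 _ commS _ _] := run.
have comm_le t t' : (t <= t')%N -> (comm E t <= comm E t')%N.
  by move/subnKC <-; elim: (t' - t)%N => [|d]; rewrite ?addn0 // addnS commS; lia.
have progress t : exists t', (comm E t < comm E t')%N.
  have [i [[ne end_i]|robust]] := ends (comm E t); first exact: pass ne end_i.
  by exists t.+1; rewrite commS -addn1 leq_add2l silent_time_gt0.
have unbounded c : exists t, (c <= comm E t)%N.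
  elim: c => [|c [t le_c]]; first by exists 0%N.
  by have [t' lt_t] := progress t; exists t'; exact: leq_ltn_trans lt_t.
case: (ex_minnP (unbounded k.+1)) => -[|t] lt_k tmin.
  by rewrite comm0 in lt_k.
have le_k : (comm E t <= k)%N.
  by rewrite leqNgt; apply/negP => /tmin; rewrite ltnn.
rewrite -(subnKC le_k); apply: silent_tube.
by move: lt_k; rewrite commS; lia.
Qed.

End Execution.
End Run.

(** * Trajectories inside the tubes of a plan *)

Section Plan.
Context {R : realType} {n m N : nat}.
Variable P : problem R n m N.
Hypothesis wp : well_posed P.

Lemma region_inj i j y : region P i y -> region P j y -> i = j.
Proof.
move=> /(labelE _ _ wp) yi /(labelE _ _ wp) yj.
by move: yi; rewrite yj => -[].
Qed.

Lemma region_corridor i j y : region P i y -> corridor P i j y.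
Proof.
case: wp => _ _ _ reg _ ri; split; first by have [_] := reg i; apply.
by case=> q [/eqP qi _] rq; apply: qi; exact: region_inj rq ri.
Qed.

(** The upper bound on the scaling is itself admissible, and a smaller scaling
    gives a smaller tube because the generating polytope contains the origin. *)
Lemma tube_corridor i j (T : tube_data R n m) l :
  tube_solution P i j T -> (l <= tlen T)%N ->
  tube_at T (teps T) l `<=` corridor P i j.
Proof.
case=> _ /interior_subset Z0 adm [[feas _ _] _] _ le_l _ [lam [lam01 lam1 ->]].
have [[_ sub] _] := adm _ le_l; have /andP[e0 eb] := feas _ le_l.
have b0 : 0 < tbar T l by exact: lt_le_trans eb.
pose z := \sum_q lam q *: tgen T q.
apply: sub; exists (tnomx T l) => //; exists (teps T l *: z).
  exists ((teps T l / tbar T l) *: z).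
    apply: conv_shrink => //; first by exists lam.
    by rewrite ler_pdivrMr // mul1r eb divr_ge0 // ltW.
  by rewrite scalerA mulrCA mulfV ?gt_eqF // mulr1.
rewrite /tube_point scaler_sumr.
under [RHS]eq_bigr do rewrite scalerDr.
rewrite big_split /= -scaler_suml lam1 scale1r; congr (_ + _).
by apply: eq_bigr => q _; rewrite !scalerA mulrC.
Qed.

Lemma tube_last i j (T : tube_data R n m) :
  tube_solution P i j T -> tube_at T (teps T) (tlen T) `<=` region P j.
Proof. by case=> _ _ _ [[_ ? _] _] _. Qed.

Variables (D : transition_system R n m N) (s : nat -> 'I_N).
Hypothesis abs : abstraction P D.
Hypothesis path : is_path P D s.
Hypothesis stationary :
  forall i, s i = s i.+1 -> forall j, (i <= j)%N -> s j = s i.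

Let T i := tube D (s i) (s i.+1).
Let e := block_start D s.

Lemma plan_tube i : s i != s i.+1 -> tube_solution P (s i) (s i.+1) (T i).
Proof.
by move=> ne; have [tubes _] := abs; have [_ /(_ i)/(tubes _ _ ne)[]] := path.
Qed.

Lemma plan_loop i :
  s i = s i.+1 -> invariance_solution P (s i) (loop D (s i)).
Proof.
move=> eqs; have [_ loops] := abs; have [_ /(_ i)] := path.
by rewrite -eqs => /loops[].
Qed.

Lemma plan_tlen_gt0 i : s i != s i.+1 -> (0 < tlen (T i))%N.
Proof. by case/plan_tube => -[]. Qed.

Lemma loop_tube_set i :
  s i = s i.+1 -> tube_set (loop D (s i)) = region P (s i).
Proof. by case/plan_loop => -[]. Qed.

(** Inside a block the tube problem makes the paired inputs robust, and so does
    robust invariance for a region in which the plan remains. At the last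
    tube of a transition it does not: the next tube of the concatenation belongs
    to another tube problem, unrelated to the inputs used there. *)
Lemma block_end_or_robust c : exists i, s i != s i.+1 /\ c = block_end D s i \/
  robust_stage P (stage_at D s c) (stage_at D s c.+1).
Proof.
have tlen0 := plan_tlen_gt0.
have [i /andP[le_c lt_c]] := in_some_block tlen0 c; exists i.
have [eqs|ne] := eqVneq (s i) (s i.+1).
  right=> q.
  have startE := block_start_loop D eqs.
  have cE : c = size (blocks D s i) by move: startE; rewrite /block_start; lia.
  have eqs' : s i.+1 = s i.+2 by rewrite -eqs (stationary eqs) // !leqW.
  have cSE : c.+1 = size (blocks D s i.+1).
    by move: startE; rewrite /block_start; lia.
  rewrite cSE (stage_at_loop tlen0 eqs') loop_tube_set // -eqs.
  move: q; rewrite cE (stage_at_loop tlen0 eqs) => q.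
  by have [_ /(_ q)[]] := plan_loop eqs.
have [lt_e|ge_e] := ltnP c (e i.+1); last first.
  left; split=> //; rewrite /block_end -/(block_start D s i.+1) -/e.
  by move: ge_e; rewrite /e /block_start; lia.
right=> q.
have [l cE] : exists l, c = (e i + l)%N.
  by exists (c - e i)%N; rewrite /e /block_start; lia.
have lt_l : (l < tlen (T i))%N.
  by move: lt_e; rewrite /e (block_start_tube tlen0 ne) cE ltn_add2l.
have l_gt0 : (0 < i -> 0 < l)%N.
  by have := leq_size_blocks tlen0 i; move: cE le_c; rewrite /e /block_start; lia.
have stage_l := stage_at_tube tlen0 ne l_gt0 (ltnW lt_l).
have stage_lS := stage_at_tube tlen0 ne (fun _ => ltn0Sn l) lt_l.
move: q; rewrite cE -addnS stage_l stage_lS => q.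
have [_ _ _ [[_ _ feas] _] _] := plan_tube ne.
by have [] := feas l q lt_l.
Qed.

Section Trajectory.
Variable x : nat -> 'cV[R]_n.
Hypothesis x0 : region P (s 0%N) (x 0%N).
Hypothesis in_tubes : forall k, tube_set (stage_at D s k) (x k).

Lemma state_in_tube i l : s i != s i.+1 -> (0 < l <= tlen (T i))%N ->
  tube_at (T i) (teps (T i)) l (x (e i + l)).
Proof.
move=> ne /andP[l0 le_l]; have := in_tubes (e i + l).
by rewrite (stage_at_tube plan_tlen_gt0).
Qed.

Lemma state_at_block_start i : region P (s i) (x (e i)).
Proof.
case: i => [|i]; first by rewrite -[e 0%N]/0%N.
have [eqs|ne] := eqVneq (s i) (s i.+1).
  have := in_tubes (e i.+1); rewrite /e block_start_loop //.
  by rewrite (stage_at_loop plan_tlen_gt0) // loop_tube_set // eqs.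
rewrite /e (block_start_tube plan_tlen_gt0 ne); apply: (tube_last (plan_tube ne)).
by apply: state_in_tube; rewrite ?leqnn ?andbT //; exact: plan_tlen_gt0.
Qed.

(** From then on every block has one tube, so every later instant is the start
    of a block. *)
Lemma state_in_loop i k : s i = s i.+1 -> (e i <= k)%N -> region P (s i) (x k).
Proof.
move=> eqs le_k; rewrite -(subnKC le_k).
have [q iq qE] : exists2 q, (i <= q)%N & e q = (e i + (k - e i))%N.
  elim: (k - e i)%N => [|d [q iq qE]]; first by exists i; rewrite ?addn0.
  have eSq r : (i <= r)%N -> e r.+1 = size (blocks D s r).
    move=> ir; rewrite /e block_start_loop //.
    by rewrite (stationary eqs (leqW ir)) (stationary eqs ir).
  case: q iq qE => [|q] iq qE.
    (* A plan that never moves has its first two blocks start at instant 0,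
       since its first block is the single initial tube. *)
    exists 2%N; first by rewrite (leq_trans iq).
    have blocks0 : size (blocks D s 0) = 0%N by [].
    have blocks1 := leq_size_blocks plan_tlen_gt0 1; have := eSq 0%N iq.
    rewrite (eSq 1%N) ?(leq_trans iq) // addnS -qE /e /block_start; lia.
  exists q.+2; first exact: leqW.
  have := leq_size_blocks plan_tlen_gt0 q.+1.
  rewrite eSq // addnS -qE /e /block_start; lia.
by rewrite -qE -(stationary eqs iq); exact: state_at_block_start.
Qed.

Lemma state_in_corridor i k : s i != s i.+1 -> (e i <= k <= e i.+1)%N ->
  corridor P (s i) (s i.+1) (x k).
Proof.
move=> ne /andP[le_k]; rewrite /e (block_start_tube plan_tlen_gt0 ne) -/e.
rewrite -(subnKC le_k) leq_add2l.
case: (k - e i)%N => [|l] le_l.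
  by rewrite addn0; apply: region_corridor; exact: state_at_block_start.
by apply: (tube_corridor (plan_tube ne) le_l); exact: state_in_tube.
Qed.

Lemma state_in_freespace k : freespace P (x k).
Proof.
have ex_i : exists i, (k < e i)%N.
  by exists k.+2; exact: (leq_block_start plan_tlen_gt0).
case: (ex_minnP ex_i) => -[|i] // lt_k imin.
have le_k : (e i <= k)%N by rewrite leqNgt; apply/negP => /imin; rewrite ltnn.
have [eqs|ne] := eqVneq (s i) (s i.+1).
  have [_ _ _ reg _] := wp; have [_] := reg (s i); apply.
  exact: state_in_loop.
have in_k : (e i <= k <= e i.+1)%N by rewrite le_k (ltnW lt_k).
by have [] := state_in_corridor ne in_k.
Qed.

(** The last condition of [tube_solution] settles the instants strictly inside
    the transition. At its two ends it says nothing, but there the state is known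
    to be in one of the two regions, and these are disjoint. *)
Lemma no_return i k k' : s i != s i.+1 -> (e i <= k)%N ->
  (k <= k' <= e i.+1)%N -> region P (s i.+1) (x k) -> ~ region P (s i) (x k').
Proof.
move=> ne le_k /andP[le_k' k'e] rk rk'.
have [eqk|nek] := eqVneq k (e i).
  case/eqP: ne; apply: region_inj (state_at_block_start i) _.
  by rewrite -eqk.
have [eqk'|nek'] := eqVneq k' (e i.+1).
  case/eqP: ne; apply: region_inj (state_at_block_start i.+1).
  by rewrite -eqk'.
have [_ _ _ _ [_ tubes_apart]] := plan_tube ne.
have eT : e i.+1 = (e i + tlen (T i))%N by exact: (block_start_tube plan_tlen_gt0 ne).
have k_in : (1 <= k - e i < tlen (T i))%N by lia.
have k'_in : (k - e i <= k' - e i < tlen (T i))%N by lia.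
have in_T r : (1 <= r - e i < tlen (T i))%N ->
    tube_at (T i) (teps (T i)) (r - e i) (x r).
  move=> r_in; have rE : (e i + (r - e i))%N = r by lia.
  by rewrite -{2}rE; apply: state_in_tube => //; lia.
have meets : tube_at (T i) (teps (T i)) (k - e i) `&` region P (s i.+1) !=set0.
  by exists (x k); split=> //; exact: in_T.
have := tubes_apart _ k_in meets _ k'_in; rewrite -subset0 => /(_ (x k')); apply.
by split=> //; apply: in_T; lia.
Qed.

Lemma is_trace_in_tubes : is_trace P x s.
Proof.
apply: (is_trace_of_transitions (e := e)) => //.
- exact: state_in_freespace.
- by move=> i; exact: block_start_leS.
- by move=> k; exists k.+1; exact: (leq_block_start plan_tlen_gt0).
- by move=> i; apply/labelE => //; exact: state_at_block_start.
- move=> i k j ne in_k /(labelE _ _ wp) rj.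
  have [_ out] := state_in_corridor ne in_k.
  have [->|nj] := eqVneq j (s i); first by left.
  have [->|nj'] := eqVneq j (s i.+1); first by right.
  by case: out; exists j.
- move=> i k k' ne le_k le_k' /(labelE _ _ wp) rk /(labelE _ _ wp).
  exact: no_return rk.
- by move=> i k eqs le_k; apply/labelE => //; exact: state_in_loop.
Qed.

End Trajectory.
End Plan.

Theorem theorem2 (R : realType) (n m N : nat) (P : problem R n m N)
    (D : transition_system R n m N) (phi : ltl 'I_N) (s : nat -> 'I_N)
    (H : nat) (x0 : 'cV[R]_n) :
  well_posed P ->
  region P (initial P) x0 ->
  abstraction P D ->
  high_level_plan P D phi s ->
  (0 < H)%N ->
  forall (w : nat -> 'cV[R]_n), (forall k, noise P (w k)) ->
  forall (E : execution R n m) (x : nat -> 'cV[R]_n) (u : nat -> 'cV[R]_m),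
    x 0%N = x0 ->
    low_level_run P D s H E x u w ->
    passes_block_ends D s E ->
    satisfies P x phi.
Proof.
move=> wp x0_init abs [path mod _ stationary] H_gt0 w Ww E x u x_0 run pass.
exists s; split=> //; apply: (is_trace_in_tubes wp abs path stationary).
  by rewrite x_0; have [-> _] := path.
apply: (run_in_tubes H_gt0 Ww run) => //.
exact: (block_end_or_robust abs path stationary).
Qed.
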